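(* Let $\mathcal{H}=(X,\mathcal{F})$ be a finite hypergraph. If Waiter has a winning strategy in the stotting Waiter-Client game on $\mathcal{H}$, then Maker has a winning strategy in the (classical) Maker-Breaker game on $\mathcal{H}$.
   Context: A hypergraph $\mathcal{H}=(X,\mathcal{F})$ consists of a set $X$ (the board) and a set $\mathcal{F}\subseteq 2^X$ (the winning sets). Maker-Breaker game on $\mathcal{H}$: two players, Maker and Breaker, claim previously unclaimed elements of $X$ in turns until all elements are claimed; in each turn Breaker first claims one element and then Maker claims one element (if one is left). So Breaker makes the first move. Maker wins if at the end Maker has claimed all elements of some $F\in\mathcal{F}$; otherwise Breaker wins. Waiter-Client game on $\mathcal{H}$: in each turn, Waiter offers two unclaimed elements of $X$ to Client; Client takes one of them and Waiter receives the other. If at the end only one unclaimed element remains, it goes to Client. Waiter wins if at the end Waiter has received all elements of some $F\in\mathcal{F}$; otherwise Client wins. Stotting Waiter-Client game on $\mathcal{H}$: defined like the Waiter-Client game, except that in each turn Client first selects an unclaimed element of the board, then Waiter adds a second unclaimed element and offers both to Client, who picks one of the two and gives the other one to Waiter. The rule for a single remaining element (it goes to Client) and the winning condition are unchanged. *)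

(* Defs.v *)
From mathcomp Require Import all_boot.

Set Implicit Arguments.
Unset Strict Implicit.
Unset Printing Implicit Defensive.

(** A finite hypergraph is given by a board [X : finType] and a family
    [F : {set {set X}}] of winning sets. *)

Definition fills (X : finType) (F : {set {set X}}) (W : {set X}) : Prop :=
  exists2 A, A \in F & A \subset W.

(** A full turn is Breaker's claim followed by Maker's.  A history is the list of
    full turns, oldest first.  When the board is odd the very last element is
    claimed by Breaker alone; it is not recorded, so a play is over as soon as
    at most one element is free. *)
Record mb_turn (X : finType) :=
  MBTurn { breaker_claim : X; maker_claim : X }.

Definition maker_set (X : finType) (h : seq (mb_turn X)) : {set X} :=
  [set x | x \in map (@maker_claim X) h].

Definition breaker_set (X : finType) (h : seq (mb_turn X)) : {set X} :=
  [set x | x \in map (@breaker_claim X) h].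

Definition mb_free (X : finType) (h : seq (mb_turn X)) : {set X} :=
  ~: (maker_set h :|: breaker_set h).

(** The second argument is the element Breaker has just claimed.  (A strategy
    of type [seq _ -> X] would not exist on the empty board, where Maker wins
    exactly when [set0] is a winning set.) *)
Definition maker_strategy (X : finType) := seq (mb_turn X) -> X -> X.

(** Legality is required at every history, not only at the reachable ones; this
    costs nothing, since a legal answer exists whenever one is demanded. *)
Definition maker_legal (X : finType) (s : maker_strategy X) : Prop :=
  forall h x, x \in mb_free h -> mb_free h :\ x != set0 ->
    s h x \in mb_free h :\ x.

Inductive mb_play (X : finType) (s : maker_strategy X) :
    seq (mb_turn X) -> Prop :=
| MBStart : mb_play s [::]
| MBStep h x :
    mb_play s h -> x \in mb_free h -> mb_free h :\ x != set0 ->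
    mb_play s (rcons h (MBTurn x (s h x))).

Definition maker_winning_strategy (X : finType) (F : {set {set X}})
    (s : maker_strategy X) : Prop :=
  maker_legal s /\
  forall h, mb_play s h -> #|mb_free h| <= 1 -> fills F (maker_set h).

Definition maker_wins (X : finType) (F : {set {set X}}) : Prop :=
  exists s : maker_strategy X, maker_winning_strategy F s.

(** A turn: the element selected by Client, the element added by Waiter, and
    whether Client keeps the selected one ([true]) or the added one ([false]).
    A single remaining element goes to Client; this is not recorded, so here
    too a play is over as soon as at most one element is free. *)
Record swc_turn (X : finType) :=
  SWCTurn { selected : X; added : X; keeps_selected : bool }.

Definition client_gets (X : finType) (t : swc_turn X) : X :=
  if keeps_selected t then selected t else added t.

Definition waiter_gets (X : finType) (t : swc_turn X) : X :=
  if keeps_selected t then added t else selected t.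

Definition waiter_set (X : finType) (h : seq (swc_turn X)) : {set X} :=
  [set x | x \in map (@waiter_gets X) h].

Definition client_set (X : finType) (h : seq (swc_turn X)) : {set X} :=
  [set x | x \in map (@client_gets X) h].

Definition swc_free (X : finType) (h : seq (swc_turn X)) : {set X} :=
  ~: (waiter_set h :|: client_set h).

(** The second argument is the element Client has just selected. *)
Definition waiter_strategy (X : finType) := seq (swc_turn X) -> X -> X.

Definition waiter_legal (X : finType) (s : waiter_strategy X) : Prop :=
  forall h x, x \in swc_free h -> swc_free h :\ x != set0 ->
    s h x \in swc_free h :\ x.

Inductive swc_play (X : finType) (s : waiter_strategy X) :
    seq (swc_turn X) -> Prop :=
| SWCStart : swc_play s [::]
| SWCStep h x (b : bool) :
    swc_play s h -> x \in swc_free h -> swc_free h :\ x != set0 ->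
    swc_play s (rcons h (SWCTurn x (s h x) b)).

Definition waiter_winning_strategy (X : finType) (F : {set {set X}})
    (s : waiter_strategy X) : Prop :=
  waiter_legal s /\
  forall h, swc_play s h -> #|swc_free h| <= 1 -> fills F (waiter_set h).

Definition stotting_waiter_wins (X : finType) (F : {set {set X}}) : Prop :=
  exists s : waiter_strategy X, waiter_winning_strategy F s.

(* Main.v *)
Require Import Defs.
From mathcomp Require Import all_boot.

(** The Maker-Breaker game is the stotting Waiter-Client game in which Client
    is restricted to always keeping the element he selected: Breaker's claim
    plays the role of Client's selection, and Maker's answer that of the element
    which Waiter adds and then receives.  Restricting Client can only
    help Waiter, so Maker wins by answering every claim of Breaker exactly as
    Waiter's winning strategy answers the corresponding selection.  The
    translation of histories [stot] preserves the two players' sets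
    ([waiter_set_stot], [client_set_stot]), and so it turns every play of
    this strategy of Maker into a play of Waiter's strategy ([mb_play_stot]). *)

Definition stot_turn {X : finType} (t : mb_turn X) : swc_turn X :=
  SWCTurn (breaker_claim t) (maker_claim t) true.

Definition stot {X : finType} (h : seq (mb_turn X)) : seq (swc_turn X) :=
  map stot_turn h.

Definition imitate {X : finType} (s : waiter_strategy X) : maker_strategy X :=
  fun h x => s (stot h) x.

Lemma waiter_set_stot {X : finType} (h : seq (mb_turn X)) :
  waiter_set (stot h) = maker_set h.
Proof. by apply/setP=> x; rewrite !inE -map_comp. Qed.

Lemma client_set_stot {X : finType} (h : seq (mb_turn X)) :
  client_set (stot h) = breaker_set h.
Proof. by apply/setP=> x; rewrite !inE -map_comp. Qed.

Lemma swc_free_stot {X : finType} (h : seq (mb_turn X)) :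
  swc_free (stot h) = mb_free h.
Proof. by rewrite /swc_free waiter_set_stot client_set_stot. Qed.

Lemma mb_play_stot {X : finType} (s : waiter_strategy X)
    (h : seq (mb_turn X)) :
  mb_play (imitate s) h -> swc_play s (stot h).
Proof.
elim=> [|{}h x _ IHh free_x nonempty]; first exact: SWCStart.
by rewrite /stot map_rcons; apply: SWCStep; rewrite ?swc_free_stot.
Qed.

Theorem proposition1p3 (X : finType) (F : {set {set X}}) :
  stotting_waiter_wins F -> maker_wins F.
Proof.
case=> s [s_legal s_wins]; exists (imitate s); split=> [h x | h play_h].
  by rewrite -swc_free_stot; apply: s_legal.
rewrite -swc_free_stot -waiter_set_stot.
by apply: s_wins; apply: mb_play_stot.
Qed.
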